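(* Let $S\neq\mathbb{N}$ be a numerical semigroup and let $T(S)=\{x\in\mathbb{N} \mid F(S)-x\in (\mathbb{Z}\setminus S)\cup\{0\}\}$ be its $T$-Set. Then $S$ is almost symmetric if and only if $T(S)$ is a numerical semigroup.
   Context: $\mathbb{N}=\{0,1,2,\dots\}$. A numerical semigroup is a subset $S\subseteq\mathbb{N}$ containing $0$, closed under addition, with finite complement in $\mathbb{N}$. The elements of $\mathbb{N}\setminus S$ are the gaps of $S$; the genus $g(S)$ is the number of gaps; for $S\neq\mathbb{N}$ the Frobenius number $F(S)$ is the largest gap. The set of pseudo-Frobenius numbers is $PF(S)=\{x\in\mathbb{N}\setminus S \mid x+s\in S \text{ for all } s\in S\setminus\{0\}\}$, and the type is $t(S)=|PF(S)|$. $S$ is called almost symmetric if $t(S)=2g(S)-F(S)$. *)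

(* Defs.v *)
From mathcomp Require Import all_boot all_order all_algebra finmap.
From mathcomp Require Import boolp classical_sets functions cardinality.

Set Implicit Arguments.
Unset Strict Implicit.
Unset Printing Implicit Defensive.

Local Open Scope classical_set_scope.

Definition numerical_semigroup (S : set nat) : Prop :=
  [/\ S 0%N,
      (forall x y, S x -> S y -> S (x + y)%N)
    & finite_set (~` S)].

Definition gaps (S : set nat) : set nat := ~` S.

(* fset_set A is the empty finite set when A is infinite, so the cardinals
   and the maximum below are meaningful because gaps S is finite when S is a
   numerical semigroup; frobenius moreover has the default value 0 when
   S = setT. *)
Definition genus (S : set nat) : nat := #|` fset_set (gaps S)|%fset.

Definition frobenius (S : set nat) : nat :=
  \max_(x <- fset_set (gaps S)) x.

Definition pseudo_frobenius (S : set nat) : set nat :=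
  [set x | gaps S x /\ forall s, (S `\ 0%N) s -> S (x + s)%N].

Definition semigroup_type (S : set nat) : nat :=
  #|` fset_set (pseudo_frobenius S)|%fset.

(* Stated in int to avoid truncated subtraction. *)
Definition almost_symmetric (S : set nat) : Prop :=
  ((semigroup_type S)%:Z = 2 * (genus S)%:Z - (frobenius S)%:Z)%R.

(* Posz @` S is S seen as a subset of the integers. *)
Definition T_set (S : set nat) : set nat :=
  [set x | (~` (Posz @` S) `|` [set 0%R])
             ((frobenius S)%:Z - x%:Z)%R].

(* Main.v *)
Require Import Defs.
From mathcomp Require Import all_boot all_order all_algebra finmap.
From mathcomp Require Import boolp classical_sets functions cardinality.
From mathcomp Require Import zify.

(** Write F for the Frobenius number.  Always S is contained in T(S), and the
    elements of T(S) outside S are F together with the gaps x such that F - x is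
    also a gap.  The reflection x |-> F - x of [0, F] shows that there are
    2g - F of them, and every pseudo-Frobenius number is one of them; hence S is
    almost symmetric iff every gap in T(S) is pseudo-Frobenius.  The latter is
    equivalent to T(S) being closed under addition, because F - x - s lies in
    T(S) exactly when its reflection x + s is not a nonzero element of S. *)

Set Implicit Arguments.
Unset Strict Implicit.

Local Open Scope classical_set_scope.

(** Turns cardinals into sums of indicators over one common range, which can be added termwise and
    reindexed. *)
Lemma card_fset_set_sum (X : set nat) (n : nat) :
  (forall x, X x -> x < n) ->
  #|` fset_set X|%fset = \sum_(i < n) `[< X i >].
Proof.
move=> Xn; have finX : finite_set X.
  by apply: (sub_finite_set _ (finite_II n)) => x /Xn.
have /perm_size -> :
    perm_eq (fset_set X) [seq i <- iota 0 n | `[< X i >]].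
  apply: uniq_perm; [exact: fset_uniq | by rewrite filter_uniq ?iota_uniq |].
  move=> x; rewrite in_fset_set // mem_filter mem_iota /= add0n.
  rewrite (_ : (x \in X) = `[< X x >]) //.
  by case: asboolP => //= /Xn ->.
rewrite size_filter -sum1_count big_mkcond -[n in iota _ n]subn0.
rewrite -[RHS](big_mkord predT (fun i => nat_of_bool `[< X i >])).
by apply: eq_bigr => i _; case: asboolP.
Qed.

Section NumericalSemigroup.

Variable S : set nat.
Hypotheses (hS : numerical_semigroup S) (hN : S <> [set: nat]).

Local Notation F := (frobenius S).

Let S0 : S 0. Proof. by case: hS. Qed.

Let SD x y : S x -> S y -> S (x + y). Proof. by case: hS => _ + _; apply. Qed.

Let gaps_finite : finite_set (gaps S). Proof. by case: hS. Qed.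

Lemma gap_le_frobenius x : gaps S x -> x <= F.
Proof.
move=> gx; apply: (@leq_bigmax_seq _ _ xpredT id) => //.
by rewrite in_fset_set // inE.
Qed.

Lemma gap_frobenius : gaps S F.
Proof.
have [x gx] : exists x, gaps S x.
  apply: contrapT => /forallNP nog; apply: hN.
  by apply/seteqP; split=> // x _; apply: contrapT => /nog.
move=> SF; have F0 : F <> 0.
  by move=> F0; have := gap_le_frobenius gx; rewrite F0 leqn0 => /eqP x0;
     apply: gx; rewrite x0.
(* A maximum is either attained or the default [0] of [\max]; [F0] rules the latter out. *)
suff : F = 0 \/ gaps S F by case.
rewrite /frobenius big_seq; elim/big_ind: _ => [|a b|i]; first by left.
- by rewrite /maxn; case: ifP.
- by rewrite in_fset_set // inE; right.
Qed.

(** For x > F the integer F - x is negative, and for x = F it is the adjoined 0; so only x < F is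
    constrained, where natural subtraction is exact. *)
Lemma T_setE x : T_set S x <-> (x < F -> gaps S (F - x)).
Proof.
split=> [[nS|/= e] xF|H]; last 1 first.
- case: (ltngtP x F) => [xF|Fx|->].
  + by left=> -[y Sy e]; apply: (H xF); rewrite (_ : F - x = y) //; lia.
  + by left=> -[y Sy e]; lia.
  + by right; rewrite /=; lia.
- by move=> SFx; apply: nS; exists (F - x) => //; lia.
- by lia.
Qed.

Lemma mem_T_set x : S x -> T_set S x.
Proof.
move=> Sx; apply/T_setE => xF SFx; apply: gap_frobenius.
by rewrite -(subnK (ltnW xF)); apply: SD.
Qed.

Lemma pseudo_frobenius_T_set :
  pseudo_frobenius S `<=` gaps S `&` T_set S.
Proof.
move=> x [gx PFx]; split=> //; apply/T_setE => xF SFx; apply: gap_frobenius.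
by rewrite -(subnKC (ltnW xF)); apply: PFx; split=> //= e; lia.
Qed.

Lemma card_gaps_T_set :
  #|` fset_set (gaps S `&` T_set S)|%fset + F = 2 * genus S.
Proof.
have ltF x : gaps S x -> x < F.+1 by move/gap_le_frobenius.
rewrite /genus (card_fset_set_sum ltF).
rewrite (@card_fset_set_sum _ F.+1); last by move=> x [/ltF].
have compl : \sum_(i < F.+1) `[< gaps S i >] + \sum_(i < F.+1) `[< S i >] = F.+1.
  rewrite -big_split /= -[RHS](card_ord F.+1) -sum1_card.
  by apply: eq_bigr => i _; rewrite asbool_neg; case: `[< _ >].
have refl : \sum_(i < F.+1) `[< S i >] = \sum_(i < F.+1) `[< S (F - i) >].
  by rewrite (reindex_inj rev_ord_inj) /=; apply: eq_bigr => i _; rewrite subSS.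
have single : \sum_(i < F.+1) (i == F :> nat) = 1.
  rewrite (bigD1 ord_max) //= eqxx big1 // => i.
  by rewrite -val_eqE /= => /negbTE ->.
(* Compared termwise: a gap i < F has F - i either a gap or in S, never both, while i = F counts on
   both sides of this split since F - F = 0 is in S. With [compl] and [refl] this reads g + 1 = |A|
   + (F + 1 - g), where A is the set of gaps in T(S). *)
have : \sum_(i < F.+1) `[< gaps S i >] + \sum_(i < F.+1) (i == F :> nat) =
    \sum_(i < F.+1) `[< (gaps S `&` T_set S) i >] +
    \sum_(i < F.+1) `[< S (F - i) >].
  rewrite -!big_split /=; apply: eq_bigr => i _.
  have iF : i <= F by rewrite -ltnS.
  case: (asboolP (gaps S i)) => [gi|/contrapT Si]; last first.
    rewrite (@asboolF ((gaps S `&` T_set S) i)); last by case.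
    rewrite asboolF => [|SFi]; last first.
      by apply: gap_frobenius; rewrite -(subnKC iF); apply: SD.
    by case: eqP => // e; case: gap_frobenius; rewrite -e.
  case: (eqVneq (i : nat) F) => [e|ne].
    rewrite e subnn !asboolT //; split; first exact: gap_frobenius.
    by apply/T_setE; rewrite ltnn.
  have ltiF : i < F by rewrite ltn_neqAle ne.
  case: (asboolP (S (F - i))) => SFi.
    by rewrite asboolF // => -[_ /T_setE /(_ ltiF)].
  by rewrite asboolT //; split=> //; apply/T_setE.
lia.
Qed.

Lemma almost_symmetric_pseudo_frobenius :
  almost_symmetric S <-> gaps S `&` T_set S `<=` pseudo_frobenius S.
Proof.
have finA : finite_set (gaps S `&` T_set S).
  by apply: (sub_finite_set _ gaps_finite) => x [].
have finP : finite_set (pseudo_frobenius S).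
  exact: sub_finite_set pseudo_frobenius_T_set finA.
have cardA := card_gaps_T_set.
rewrite /almost_symmetric /semigroup_type; split=> [asym|AP].
  have : fset_set (pseudo_frobenius S) == fset_set (gaps S `&` T_set S).
    (* Almost symmetry makes both cardinals 2g - F, so the inclusion already known is an
       equality. *)
    rewrite eqEfcard; apply/andP; split; last by lia.
    apply/fsubsetP => x; rewrite !in_fset_set // !inE.
    exact: pseudo_frobenius_T_set.
  by move/eqP/(fset_set_inj finP finA) => ->.
rewrite (_ : pseudo_frobenius S = gaps S `&` T_set S); first by lia.
by apply/seteqP; split=> //; exact: pseudo_frobenius_T_set.
Qed.

Lemma T_setD x y : gaps S `&` T_set S `<=` pseudo_frobenius S ->
  T_set S x -> T_set S y -> T_set S (x + y).
Proof.
(* If both summands lie in S, so does the sum; otherwise commutativity puts a gap first. *)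
move=> AP; wlog nSx : x y / gaps S x.
  move=> wl Tx Ty; have [Sx|] := pselect (S x); last by move=> ?; exact: wl.
  have [Sy|nSy] := pselect (S y); first by apply: mem_T_set; exact: SD.
  by rewrite addnC; exact: wl.
move=> Tx /T_setE Ty; apply/T_setE => xyF Sz.
have [_ PFx] := AP _ (conj nSx Tx).
have yF : y < F by lia.
(* Adding the pseudo-Frobenius number x to the nonzero element F - (x + y) of S would put F - y in
   S. *)
apply: (Ty yF); rewrite (_ : F - y = x + (F - (x + y))); last by lia.
by apply: PFx; split=> //=; lia.
Qed.

Lemma T_set_pseudo_frobenius :
  (forall x y, T_set S x -> T_set S y -> T_set S (x + y)) ->
  gaps S `&` T_set S `<=` pseudo_frobenius S.
Proof.
move=> TD x [gx Tx]; split=> // s [Ss /= s0]; apply: contrapT => gxs.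
have xsF := gap_le_frobenius gxs.
(* Adding x to this element gives F - s, whose reflection s would have to be a gap. *)
have Tz : T_set S (F - (x + s)).
  by apply/T_setE => _; rewrite subKn.
have /T_setE := TD _ _ Tx Tz.
rewrite (_ : x + (F - (x + s)) = F - s); last by lia.
by rewrite subKn; [apply=> //; lia | lia].
Qed.

End NumericalSemigroup.

Unset Implicit Arguments.

Theorem theorem1p1 (S : set nat) (hS : numerical_semigroup S)
    (hN : S <> [set: nat]) :
  almost_symmetric S <-> numerical_semigroup (T_set S).
Proof.
rewrite almost_symmetric_pseudo_frobenius //; split=> [AP|[_ TD _]]; last first.
  exact: T_set_pseudo_frobenius.
have ST := mem_T_set hS hN.
case: (hS) => S0 _ finG; split; first exact: ST.
  by move=> x y; exact: T_setD.
by apply: (sub_finite_set _ finG) => x nTx /ST.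
Qed.
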